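(* Let $S$ be an involution $*$-intra-regular $poe$-semigroup with greatest element $e$. Then, for every $x\in S$, we have $ex^*e\in (x^* )_{\mathcal N}$, and $ex^*e\ge y$ for every $y\in (x)_{\mathcal N}$.
   Context: A $poe$-semigroup is a semigroup $S$ with a partial order $\le$ such that $a\le b$ implies $ac\le bc$ and $ca\le cb$ for all $c\in S$, and with a greatest element $e$. An involution on it is a unary operation $*$ with $(a^* )^*=a$, $(ab)^*=b^*a^*$, and $a\le b\Rightarrow a^*\le b^*$. $S$ is $*$-intra-regular if $a\le ea^*a^*e$ for all $a\in S$. A filter of $S$ is a (nonempty) subsemigroup $F$ such that (1) $a,b\in S$ and $ab\in F$ imply $a\in F$ and $b\in F$, and (2) $a\in F$, $b\in S$, $b\ge a$ imply $b\in F$. $N(x)$ denotes the smallest filter of $S$ containing $x$. $\mathcal N$ is the equivalence relation on $S$ given by $(x,y)\in\mathcal N$ iff $N(x)=N(y)$, and $(x)_{\mathcal N}$ is the $\mathcal N$-class of $x$. *)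

(* Defs.v *)
From HB Require Import structures.
From mathcomp Require Import all_boot all_order.
From mathcomp Require Import boolp classical_sets.

Set Implicit Arguments.
Unset Strict Implicit.
Unset Printing Implicit Defensive.

Import Order.Theory.

Local Open Scope classical_set_scope.
Local Open Scope group_scope.
Local Open Scope order_scope.

(* The greatest element e is \top : S. *)
HB.mixin Record Semigroup_TPOrder_isPoeSemigroup (d : Order.disp_t) S
    of Semigroup S & Order.TPOrder d S := {
  lemul2r : forall a b c : S, a <= b -> a * c <= b * c;
  lemul2l : forall a b c : S, a <= b -> c * a <= c * b
}.

#[short(type="poeSemigroupType")]
HB.structure Definition PoeSemigroup (d : Order.disp_t) :=
  { S of Semigroup S & Order.TPOrder d S
       & Semigroup_TPOrder_isPoeSemigroup d S }.

HB.mixin Record PoeSemigroup_hasInvolution (d : Order.disp_t) S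
    of PoeSemigroup d S := {
  star : S -> S;
  starK : forall a : S, star (star a) = a;
  starM : forall a b : S, star (a * b) = star b * star a;
  le_star : forall a b : S, a <= b -> star a <= star b
}.

#[short(type="invPoeSemigroupType")]
HB.structure Definition InvPoeSemigroup (d : Order.disp_t) :=
  { S of PoeSemigroup d S & PoeSemigroup_hasInvolution d S }.

Notation "a ^*" := (star a) : group_scope.

Definition star_intra_regular (d : Order.disp_t) (S : invPoeSemigroupType d) :=
  forall a : S, a <= \top * a^* * a^* * \top.

Definition subsemigroup (S : semigroupType) (F : set S) :=
  F !=set0 /\ forall a b, F a -> F b -> F (a * b).

Definition semigroup_filter (d : Order.disp_t) (S : poeSemigroupType d)
    (F : set S) :=
  [/\ subsemigroup F,
      forall a b : S, F (a * b) -> F a /\ F b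
    & forall a b : S, F a -> a <= b -> F b].

Definition filterN (d : Order.disp_t) (S : poeSemigroupType d) (x : S) : set S :=
  smallest (@semigroup_filter d S) [set x].

(* [smallest] is an intersection; here it is itself a filter, hence a genuine
   smallest filter containing x. *)
Lemma filterN_least (d : Order.disp_t) (S : poeSemigroupType d) (x : S) :
  [/\ semigroup_filter (filterN x), filterN x x
    & forall F : set S, semigroup_filter F -> F x -> filterN x `<=` F].
Proof.
have xx : filterN x x by move=> F [_]; apply.
split=> //; last first.
  by move=> F Ff Fx; apply: smallest_sub => // _ ->.
split; first split.
- by exists x.
- move=> a b Fa Fb F FF; have [[[_ FM] _ _] _] := FF.
  by apply: FM; [exact: Fa | exact: Fb].
- move=> a b Fab; split=> F FF; have [[_ FD _] _] := FF;
  by have [] := FD _ _ (Fab F FF).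
- move=> a b Fa ab F FF; have [[_ _ FU] _] := FF.
  exact: FU (Fa F FF) ab.
Qed.

Definition relN (d : Order.disp_t) (S : poeSemigroupType d) (x y : S) : Prop :=
  filterN x = filterN y.

Definition classN (d : Order.disp_t) (S : poeSemigroupType d) (x : S) : set S :=
  [set y | relN y x].

(* Main.v *)
(** Since [e] lies in every filter, [a <= e a' a' e] (writing [a'] for the
    involution) shows that filters are stable under the involution, and that
    a filter contains [e a e] iff it contains [a].  Applying the hypothesis twice
    gives ordinary intra-regularity [a <= e a a e], and then [{z | y <= e z e}]
    is a filter containing [y]; it therefore contains [N(y)], and in particular
    [x'] whenever [N(y) = N(x)]. *)
Require Import Defs.
From mathcomp Require Import all_boot all_order.
From mathcomp Require Import boolp classical_sets.

Import Order.Theory.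

Local Open Scope classical_set_scope.
Local Open Scope group_scope.
Local Open Scope order_scope.

Lemma lemul2 {d : Order.disp_t} {S : poeSemigroupType d} (a b a' b' : S) :
  a <= a' -> b <= b' -> a * b <= a' * b'.
Proof.
by move=> aa' bb'; apply: le_trans (lemul2r _ _ b aa') (lemul2l _ _ a' bb').
Qed.

(** Up to [mulgA], this isolates any inner factor of a longer product by absorbing the rest into
    [\top]. *)
Lemma lemul2_top {d : Order.disp_t} {S : poeSemigroupType d} (a b c : S) :
  a * b * c <= \top * b * \top.
Proof. by rewrite lemul2 ?lex1 ?lemul2r ?lex1. Qed.

Definition intra_regular {d : Order.disp_t} (S : poeSemigroupType d) :=
  forall a : S, a <= \top * (a * a) * \top.

(** The bound on [a^*] replaces only the first [a^*] in the bound on [a]; the second is absorbed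
    into [\top]. *)
Lemma star_intra_regularW {d : Order.disp_t} {S : invPoeSemigroupType d} :
  star_intra_regular S -> intra_regular S.
Proof.
move=> irS a.
have irS_star : a^* <= \top * (a * a) * \top.
  by have := irS a^*; rewrite starK !mulgA.
apply: le_trans (irS a) _.
apply: le_trans (lemul2r _ _ _ (lemul2r _ _ _ (lemul2l _ _ _ irS_star))) _.
by have := lemul2_top (\top * \top) (a * a) (\top * a^* * \top); rewrite !mulgA.
Qed.

Lemma filter_top {d : Order.disp_t} {S : poeSemigroupType d} {F : set S} :
  semigroup_filter F -> F \top.
Proof. by case=> [[[a Fa] _] _ Fup]; apply: Fup Fa (lex1 a). Qed.

Lemma filter_mul_top {d : Order.disp_t} {S : poeSemigroupType d} {F : set S}
    (a : S) : semigroup_filter F -> F (\top * a * \top) <-> F a.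
Proof.
move=> FF; have [[_ FM] FD _] := FF; have Ftop := filter_top FF.
by split=> [/FD[/FD[]]|Fa] //; do 2!apply: (FM) => //.
Qed.

Lemma filter_star {d : Order.disp_t} {S : invPoeSemigroupType d} {F : set S}
    (a : S) : star_intra_regular S -> semigroup_filter F -> F a -> F a^*.
Proof.
move=> irS FF Fa; have [_ FD Fup] := FF.
by have /FD[/FD[]] := Fup _ _ Fa (irS a).
Qed.

Lemma filterN_sub {d : Order.disp_t} {S : poeSemigroupType d} (x y : S) :
  filterN y x -> filterN x `<=` filterN y.
Proof.
by have [Fy _ _] := filterN_least y; have [_ _] := filterN_least x; apply.
Qed.

Lemma intra_regular_filter {d : Order.disp_t} {S : poeSemigroupType d} (y : S) :
  intra_regular S -> semigroup_filter [set z : S | y <= \top * z * \top].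
Proof.
move=> irS; split=> [|a b /= yab|a b /= ya ab].
- split=> [|a b /= ya yb].
    exists (y * y); exact: irS.
  (* Squaring [b * \top * (\top * a)] puts the final [a] of one copy next to the initial [b] of the
     other, creating the factor [a * b]. Hence [yb] is used before [ya] below. *)
  have ba : b * \top * (\top * a) <= \top * (a * b) * \top.
    apply: le_trans (irS _) _.
    have := lemul2_top (\top * b * \top * \top) (a * b) (\top * \top * a * \top).
    by rewrite !mulgA.
  apply: le_trans (irS y) _.
  apply: le_trans (lemul2r _ _ _ (lemul2l _ _ _ (lemul2 _ _ _ _ yb ya))) _.
  have := lemul2r _ _ (\top * \top) (lemul2l _ _ (\top * \top) ba).
  rewrite !mulgA => /le_trans; apply.
  have := lemul2_top (\top * \top * \top) (a * b) (\top * \top * \top).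
  by rewrite !mulgA.
- split; apply: le_trans yab _.
    by have := lemul2_top \top a (b * \top); rewrite !mulgA.
  by have := lemul2_top (\top * a) b \top; rewrite !mulgA.
- by apply: le_trans ya _; apply: lemul2r; apply: lemul2l.
Qed.

Theorem proposition27 (d : Order.disp_t) (S : invPoeSemigroupType d)
    (intra_regS : star_intra_regular S) (x : S) :
  classN (x^*) (\top * x^* * \top) /\
  (forall y : S, classN x y -> \top * x^* * \top >= y).
Proof.
split=> [|y Nyx].
  have [Fx xx _] := filterN_least x^*.
  have [Fexe exe _] := filterN_least (\top * x^* * \top).
  by rewrite /classN /= /relN; apply/seteqP; split; apply: filterN_sub;
    apply/filter_mul_top.
have irS := star_intra_regularW intra_regS.
have [Fy _ leastNy] := filterN_least y.
have Nyxs : filterN y x^*.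
  apply: (filter_star _ intra_regS Fy).
  by have [_ xx _] := filterN_least x; rewrite (Nyx : filterN y = filterN x).
apply: (leastNy _ (intra_regular_filter y irS)) => /=.
  (* Membership of [y] itself: the second [y] of [y * y] is absorbed into [\top]. *)
  apply: le_trans (irS y) _.
  by have := lemul2_top \top y (y * \top); rewrite !mulgA.
exact: Nyxs.
Qed.
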